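(* Let $\alpha$ be a real number with $\alpha-\max G\neq 0,-1,-2,\ldots$, and assume that $\Omega_G(n)\neq 0$ for $n=0,1,2,\ldots$. If $G$ is a segment, i.e. $G=\{f,f+1,\ldots,f+h\}$ for some integers $f>0$ and $h\ge 0$, then $$\tilde{\mathfrak D}_n=\{p(x)x^{\max G+1}+c:\ p\in\mathbb{R}[x],\ c\in\mathbb{R}\}.$$
   Context: For $\alpha\in\mathbb{R}$ the Laguerre polynomials are $L_n^{\alpha}(x)=\sum_{j=0}^n\frac{(-x)^j}{j!}\binom{n+\alpha}{n-j}$ for $n\ge 0$, and $L_n^\alpha=0$ for $n<0$ (here $\binom{y}{k}=y(y-1)\cdots(y-k+1)/k!$). $G=\{g_1<g_2<\cdots<g_m\}$ is a finite set of $m\ge 1$ positive integers and, for each $g\in G$, $\mathcal{R}_g$ is a real polynomial of degree $g$ with leading coefficient $1/g!$. Put $\Omega_G(x)=\det\left(\mathcal{R}_{g_l}(x-j)\right)_{l,j=1}^m$. The polynomials $(q_n)_{n\ge 0}$ are defined by $$q_n(x)=\begin{vmatrix} L^\alpha_n(x) & L^\alpha_{n-1}(x) & \cdots & L^\alpha_{n-m}(x)\\ \mathcal{R}_{g_1}(n)&\mathcal{R}_{g_1}(n-1)&\cdots&\mathcal{R}_{g_1}(n-m)\\ \vdots&\vdots&\ddots&\vdots\\ \mathcal{R}_{g_m}(n)&\mathcal{R}_{g_m}(n-1)&\cdots&\mathcal{R}_{g_m}(n-m)\end{vmatrix},$$ with the convention $q_k=0$ for $k<0$. $\tilde{\mathfrak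 D}_n$ (where the subscript $n$ only indicates the discrete variable) is the set of all polynomials $Q\in\mathbb{R}[x]$ for which there is a difference operator $D_n=\sum_{i=s}^r\gamma_{n,i}\,\mathfrak{s}_i$, with $s\le r$ integers (independent of $n$), $\mathfrak{s}_i$ the shift $\mathfrak{s}_i(f(n))=f(n+i)$, and $(\gamma_{n,i})_{n\ge0}$ sequences of real numbers with $\gamma_{n,s},\gamma_{n,r}\neq0$ for $n\ge0$, such that $D_n(q_n)=Q(x)q_n$, i.e. $\sum_{i=s}^r\gamma_{n,i}q_{n+i}(x)=Q(x)q_n(x)$ for all $n\ge 0$. The zero operator is also allowed (so $0\in\tilde{\mathfrak D}_n$). *)

(* Defs.v *)
From HB Require Import structures.
From mathcomp Require Import all_boot all_order all_algebra.
From mathcomp Require Import boolp classical_sets reals.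

Set Implicit Arguments.
Unset Strict Implicit.
Unset Printing Implicit Defensive.

Import Order.TTheory GRing.Theory Num.Theory.

Local Open Scope ring_scope.

Section LaguerreType.
Variable R : realType.

Definition gbinom (y : R) (k : nat) : R :=
  (\prod_(i < k) (y - i%:R)) / (k`!)%:R.

Definition laguerre (alpha : R) (n : int) : {poly R} :=
  if n is Posz k then
    \sum_(j < k.+1)
      (gbinom (k%:R + alpha) (k - j) / (j`!)%:R) *: (- 'X) ^+ j
  else 0.

(* A finite set G = {g_1 < ... < g_m} is given by its increasing enumeration,
   a sequence of size m, and the family of polynomials P is indexed by the
   elements of G (its values outside G are irrelevant).  Ordinals start at 0,
   hence the shift by j.+1. *)
Definition Omega (G : seq nat) (P : nat -> {poly R}) (x : R) : R :=
  \det (\matrix_(l < size G, j < size G) (P (nth 0%N G l)).[x - j.+1%:R]).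

Definition q_casorati (alpha : R) (G : seq nat) (P : nat -> {poly R}) (n : int) :
    {poly R} :=
  if n is Negz _ then 0 else
  \det (\matrix_(i < (size G).+1, j < (size G).+1)
          if (i : nat) is l.+1 then ((P (nth 0%N G l)).[(n - j%:Z)%:~R])%:P
          else laguerre alpha (n - j%:Z)).

(* The value at n of sum_{i = s}^r gamma_{n,i} f(n+i), when s <= r. *)
Definition diff_op (s r : int) (gamma : nat -> int -> R) (f : int -> {poly R})
    (n : nat) : {poly R} :=
  \sum_(k < `|r - s|%N.+1) gamma n (s + k%:Z) *: f (n%:Z + (s + k%:Z)).

(* The second disjunct is the zero operator. *)
Definition admissible (s r : int) (gamma : nat -> int -> R) : Prop :=
  (forall n, gamma n s != 0 /\ gamma n r != 0) \/ (forall n i, gamma n i = 0).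

Definition Dtilde (q : int -> {poly R}) : set {poly R} :=
  [set Q | exists s r : int, exists gamma : nat -> int -> R,
     [/\ s <= r, admissible s r gamma &
         forall n : nat, diff_op s r gamma q n = Q * q n%:Z]]%classic.

End LaguerreType.

(* Main.v *)
Require Import Defs.
From HB Require Import structures.
From mathcomp Require Import all_boot all_order all_algebra.
From mathcomp Require Import boolp classical_sets reals.
From mathcomp Require Import ring lra zify.

Set Implicit Arguments.
Unset Strict Implicit.
Unset Printing Implicit Defensive.

Import Order.TTheory GRing.Theory Num.Theory.

Local Open Scope ring_scope.

(** Let [J] be the operator on two-sided sequences with
[(J f)(n) = -(n + 1) f(n + 1) + (2n + alpha + 1) f(n) - (n + alpha) f(n - 1)].
The three term recurrence of the Laguerre polynomials says that [J] acts on
[n |-> L_n] as multiplication by [x]; with [L_n = 0] for [n < 0] this is true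
at every integer, since [n + 1] vanishes at [n = -1].  Hence [Q(J)] acts as
multiplication by [Q].  Let [B] be the operator sending a sequence [f] to the
Casorati determinant of [f] and the polynomials of the family.  Then
[q_n = (B L)(n)], the space [W] spanned by the family is killed by [B], and
the extreme coefficients of [B] at [n] are, up to sign, [Omega n] and
[Omega (n + 1)].

The heart of the matter is that [Q] belongs to the algebra exactly when [Q(J)]
maps [W] into itself.

If it does, [B Q(J)] kills [W].  Dividing it by [B], leading term first, only
divides by values of [Omega] at nonnegative integers
([casorati_division]).  The remainder at [n] is a functional which either lives
on negative indices, where [L] vanishes, or lives on [size G] consecutive
points and kills [W], so that it is zero because a value of [Omega] is the
determinant of the corresponding linear system ([local_eq0]).  The extreme
coefficients of the quotient are found by comparing the extreme coefficients
of both sides, and the assumption on [alpha] makes them nonzero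
([quotient_row], [Dtilde_of_kernel]).

Conversely, a difference equation [D q = Q q] says that [D B] and [B Q(J)]
agree on [L].  Away from the origin both only involve nonnegative indices, and
the [L_n] with [n >= 0] are linearly independent, so that they agree on every
sequence; thus [B Q(J) w = 0] for [w] in [W] and [n] large.  The solutions of
[B f = 0] form a space whose dimension is the order of [B], and interpolation
identifies [Q(J) w] with an element of [W] ([span_of_Dtilde]).

It remains to see which [Q(J)] preserve [W].  On polynomials in [n], [J] sends
the rising factorial [(n + 1) ... (n + k)] to [k (alpha - k)] times the
preceding one ([jacobi_rising]) and constants to zero; by the assumption on
[alpha] it lowers each degree between [1] and [max G] by exactly one.  Hence
[J^(max G + 1)] kills [W], and [Q = p x^(max G + 1) + c] acts there as the
scalar [c].  If instead [x^k] with [1 <= k <= max G] is the first nonconstant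
monomial of [Q], choose in the segment [G] the degree [max k f]: then
[Q(J) - Q(0)] sends a polynomial of that degree to a nonzero one of degree
less than [f], and [W] contains none. *)

(** * The Laguerre recurrence on all integers *)

Section Recurrence.
Variables (R : realType) (alpha : R).

Lemma gbinomS (y : R) (k : nat) :
  k.+1%:R * gbinom y k.+1 = (y - k%:R) * gbinom y k.
Proof.
rewrite /gbinom big_ord_recr /= factS natrM.
field.
by rewrite !nat1r !pnatr_eq0 -lt0n fact_gt0.
Qed.

Lemma gbinom_pascal (y : R) (k : nat) :
  gbinom (y + 1) k.+1 = gbinom y k.+1 + gbinom y k.
Proof.
elim: k => [|k IH].
  by rewrite /gbinom !big_ord1 big_ord0 !fact0 factS fact0 !divr1 !subr0.
have kS_neq0 : k.+2%:R != 0 :> R by rewrite pnatr_eq0.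
apply: (mulfI kS_neq0); rewrite mulrDr !gbinomS IH.
by have := gbinomS y k; rewrite -!natr1; lra.
Qed.

(** Extension by zero to negative lower indices makes the identities below
hold for every integer, so that no boundary case is left. *)
Definition gbinomz (y : R) (k : int) : R :=
  if k is Posz k then gbinom y k else 0.

Lemma gbinomzS (y : R) (k : int) :
  (k%:~R + 1) * gbinomz y (k + 1) = (y - k%:~R) * gbinomz y k.
Proof.
case: k => [k|[|k]].
- by rewrite -PoszD addn1 /= -gbinomS -natr1.
- by rewrite [RHS]mulr0 (_ : (Negz 0)%:~R = -1) // addNr mul0r.
by rewrite (_ : Negz k.+1 + 1 = Negz k) ?mulr0 //; lia.
Qed.

Lemma gbinomz_pascal (y : R) (k : int) :
  gbinomz (y + 1) (k + 1) = gbinomz y (k + 1) + gbinomz y k.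
Proof.
case: k => [k|[|k]].
- by rewrite -PoszD addn1 /= gbinom_pascal.
- by rewrite (_ : Negz 0 + 1 = 0) // /= /gbinom !big_ord0 addr0.
by rewrite (_ : Negz k.+1 + 1 = Negz k) ?addr0 //; lia.
Qed.

Lemma gbinomz_absorb (y : R) (k : int) :
  y * gbinomz (y - 1) (k - 1) = k%:~R * gbinomz y k.
Proof.
have := gbinomz_pascal (y - 1) (k - 1); have := gbinomzS (y - 1) (k - 1).
by rewrite !subrK intrB => h1 ->; rewrite mulrDr; lra.
Qed.

Lemma coef_laguerre (n : int) (j : nat) :
  (laguerre alpha n)`_j =
  (-1) ^+ j / (j`!)%:R * gbinomz (n%:~R + alpha) (n - j%:Z).
Proof.
case: n => [n|n] /=; last first.
  by rewrite coef0 (_ : Negz n - j%:Z = Negz (n + j)) ?mulr0 //; lia.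
under eq_bigr => i _ do
  rewrite exprNn -(rmorph_sign polyC) mul_polyC scalerA.
rewrite -(poly_def n.+1 (fun i => gbinom (n%:R + alpha) (n - i) / i`!%:R * (-1) ^+ i)).
rewrite coef_poly ltnS; case: leqP => [le_jn|lt_nj].
  by rewrite subzn //= -pmulrn; ring.
have -> : n%:Z - j%:Z = Negz (j - n).-1 by lia.
by rewrite mulr0.
Qed.

Lemma size_laguerre (n : nat) : size (laguerre alpha n) = n.+1.
Proof.
apply/eqP; rewrite eqn_leq; apply/andP; split.
  apply/leq_sizeP => j lt_nj; rewrite coef_laguerre.
  by rewrite (_ : n%:Z - j%:Z = Negz (j - n).-1) ?mulr0 //; lia.
rewrite ltnNge; apply/negP => /leq_sizeP /(_ n (leqnn n)) /eqP.
rewrite coef_laguerre subrr /= /gbinom big_ord0 fact0 divr1 mulr1.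
by rewrite mulf_eq0 signr_eq0 invr_eq0 pnatr_eq0 -leqn0 leqNgt fact_gt0.
Qed.

(** Multiplication by the variable, read on the index of the Laguerre
polynomials: this is their three term recurrence. *)
Definition jacobi (f : int -> {poly R}) (n : int) : {poly R} :=
  - (n%:~R + 1) *: f (n + 1) + (2 * n%:~R + alpha + 1) *: f n
  - (n%:~R + alpha) *: f (n - 1).

(** The recurrence holds at all integers because the coefficient of
[f (n + 1)] vanishes at [n = -1]. *)
Lemma jacobi_laguerre (n : int) :
  jacobi (laguerre alpha) n = 'X * laguerre alpha n.
Proof.
apply/polyP => j; rewrite /jacobi !(coefB, coefD, coefN, coefZ) coefXM !coef_laguerre.
set y := n%:~R + alpha; set k := n - j%:Z.
have -> : (n + 1)%:~R + alpha = y + 1 by rewrite /y intrD; ring.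
have -> : (n - 1)%:~R + alpha = y - 1 by rewrite /y intrB; ring.
have -> : n + 1 - j%:Z = k + 1 by rewrite /k; ring.
have -> : n - 1 - j%:Z = k - 1 by rewrite /k; ring.
have nE : n%:~R = k%:~R + j%:R :> R by rewrite /k intrB -pmulrn; ring.
have h1 := gbinomzS y k; have h2 := gbinomz_absorb y k.
have h3 := gbinomz_pascal y k.
have yE : y = k%:~R + j%:R + alpha by rewrite /y nE.
have h : - (n%:~R + 1) * gbinomz (y + 1) (k + 1)
    + (2 * n%:~R + alpha + 1) * gbinomz y k - y * gbinomz (y - 1) (k - 1)
    = - j%:R * gbinomz y (k + 1).
  by rewrite h2 h3 nE; move: h1; rewrite yE; lra.
transitivity ((-1) ^+ j / j`!%:R * (- j%:R * gbinomz y (k + 1))).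
  by rewrite -h; ring.
case: j @k nE yE {h1 h2 h3} h => [|j] k nE yE h /=; first by rewrite oppr0 mul0r mulr0.
rewrite (_ : n - j%:Z = k + 1); last by rewrite /k; lia.
rewrite factS natrM exprS.
by field; rewrite !nat1r !pnatr_eq0 -lt0n fact_gt0.
Qed.

End Recurrence.

(** * The recurrence operator on polynomial sequences *)

Section PolynomialSequences.
Variables (R : realType) (alpha : R).

Definition eval_seq (w : {poly R}) (n : int) : {poly R} := (w.[n%:~R])%:P.

Definition jacobi_poly (w : {poly R}) : {poly R} :=
  - ('X + 1) * (w \Po ('X + 1)) + (2 *: 'X + (alpha + 1)%:P) * w
  - ('X + alpha%:P) * (w \Po ('X - 1)).

Lemma jacobi_poly_is_linear : linear jacobi_poly.
Proof.
move=> a u v; rewrite /jacobi_poly !comp_polyD !comp_polyZ -!mul_polyC.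
ring.
Qed.

HB.instance Definition _ := GRing.isLinear.Build R {poly R} {poly R} *:%R
  jacobi_poly jacobi_poly_is_linear.

Lemma jacobi_eval (w : {poly R}) :
  jacobi alpha (eval_seq w) = eval_seq (jacobi_poly w).
Proof.
apply: funext => n; rewrite /jacobi /eval_seq /jacobi_poly -!mul_polyC -!polyCM.
rewrite -!(polyCD, polyCN); congr polyC.
rewrite !hornerE !horner_comp !hornerE intrD intrB /=.
ring.
Qed.

Definition rising (k : nat) : {poly R} := \prod_(i < k) ('X + i.+1%:R%:P).

Lemma risingS k : rising k.+1 = rising k * ('X + k.+1%:R%:P).
Proof. by rewrite /rising big_ord_recr. Qed.

Lemma rising_succ k : ('X + 1) * (rising k \Po ('X + 1)) = rising k.+1.
Proof.
rewrite /rising big_ord_recl rmorph_prod; congr (_ * _).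
apply: eq_bigr => i _; rewrite rmorphD /= comp_polyX comp_polyC.
by rewrite -addrA -polyC1 -polyCD nat1r.
Qed.

Lemma rising_pred k : rising k.+1 \Po ('X - 1) = 'X * rising k.
Proof.
rewrite -rising_succ rmorphM rmorphD /= comp_polyX rmorph1 subrK -comp_polyA.
by rewrite comp_polyD comp_polyX -[1]/(1%:P) comp_polyC subrK comp_polyXr.
Qed.

Lemma rising_monic k : rising k \is monic.
Proof.
by apply: monic_prod => i _; rewrite -[_%:P]opprK -polyCN monicXsubC.
Qed.

Lemma size_rising k : size (rising k) = k.+1.
Proof.
elim: k => [|k IH]; first by rewrite /rising big_ord0 size_poly1.
by rewrite risingS -[_%:P]opprK -polyCN size_monicM ?rising_monic ?polyXsubC_eq0
  ?IH ?size_XsubC ?addn2 // -size_poly_eq0 size_XsubC.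
Qed.

(** In the basis of rising factorials the recurrence operator is a weighted
shift; the weights [k (alpha - k)] are where the restriction on the parameter
enters. *)
Lemma jacobi_rising k :
  jacobi_poly (rising k.+1) = (k.+1%:R * (alpha - k.+1%:R)) *: rising k.
Proof.
rewrite /jacobi_poly rising_pred mulNr rising_succ !risingS -!mul_polyC.
rewrite -![k.+2%:R]natr1 !(polyCD, polyCM, polyCN) polyC1.
ring.
Qed.

Lemma jacobi_rising0 : jacobi_poly (rising 0) = 0.
Proof.
rewrite /jacobi_poly /rising big_ord0 !rmorph1 -mul_polyC polyCD.
ring.
Qed.

(** Expanding in rising factorials, only the top one contributes to the new
leading coefficient.  For [k = 0] both sides of the equation vanish. *)
Lemma jacobi_poly_lead (k : nat) (w : {poly R}) :
  (size w <= k.+1)%N ->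
  (size (jacobi_poly w) <= k)%N /\
  (jacobi_poly w)`_k.-1 = k%:R * (alpha - k%:R) * w`_k.
Proof.
elim: k w => [|k IH] w le_w.
  have -> : w = w`_0 *: rising 0.
    by rewrite /rising big_ord0 alg_polyC; apply: size1_polyC.
  by rewrite linearZ /= jacobi_rising0 scaler0 size_poly0 coef0 !mul0r.
set r := w - w`_k.+1 *: rising k.+1.
have coef_rising : (rising k.+1)`_k.+1 = 1.
  by have /monicP := rising_monic k.+1; rewrite /lead_coef size_rising.
have le_r : (size r <= k.+1)%N.
  apply/leq_sizeP => j; rewrite leq_eqVlt coefB coefZ => /orP[/eqP<-|lt_kj].
    by rewrite coef_rising mulr1 subrr.
  rewrite [w`_j]nth_default ?(leq_trans le_w) //.
  by rewrite [(rising _)`_j]nth_default ?size_rising // mulr0 subr0.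
have [le_Jr _] := IH r le_r.
have -> : jacobi_poly w =
    (w`_k.+1 * (k.+1%:R * (alpha - k.+1%:R))) *: rising k + jacobi_poly r.
  by rewrite -scalerA -jacobi_rising -linearZ -linearD /r addrC subrK.
split.
  rewrite (leq_trans (size_polyD _ _)) // geq_max (leq_trans (size_scale_leq _ _)).
    by rewrite (leq_trans le_Jr).
  by rewrite size_rising.
have coef_rk : (rising k)`_k = 1.
  by have /monicP := rising_monic k; rewrite /lead_coef size_rising.
rewrite /= coefD coefZ coef_rk (nth_default _ le_Jr).
ring.
Qed.

Lemma size_jacobi_poly_le (w : {poly R}) : (size (jacobi_poly w) <= (size w).-1)%N.
Proof.
have [->|w_neq0] := eqVneq w 0; first by rewrite linear0 size_poly0.
by have [] := @jacobi_poly_lead (size w).-1 w (leqSpred _).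
Qed.

Lemma size_iter_jacobi_le k (w : {poly R}) :
  (size (iter k jacobi_poly w) <= size w - k)%N.
Proof.
elim: k => [|k IH]; first by rewrite subn0.
by rewrite iterS (leq_trans (size_jacobi_poly_le _)) // subnS -!subn1 leq_sub2r.
Qed.

Lemma size_iter_jacobi k (w : {poly R}) :
  (k < size w)%N ->
  (forall i : nat, (i < size w)%N -> (0 < i)%N -> alpha != i%:R) ->
  size (iter k jacobi_poly w) = (size w - k)%N.
Proof.
move=> lt_kw alphaN; elim: k lt_kw => [|k IH] lt_kw; first by rewrite subn0.
set v := iter k jacobi_poly w.
have szv : size v = (size w - k)%N by apply: IH; exact: ltnW.
have [e szvE] : exists e, size v = e.+2.
  by exists (size w - k).-2; rewrite szv; lia.
have lt_e : (e.+1 < size w)%N.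
  by rewrite (leq_trans _ (leq_subr k _)) // -szv szvE.
have [le_Jv] := @jacobi_poly_lead e.+1 v (eq_leq szvE).
rewrite iterS -/v (_ : (size w - k.+1)%N = e.+1); last by rewrite subnS -szv szvE.
move=> /= coefE; apply/eqP; rewrite eqn_leq le_Jv ltnNge.
apply/negP => /leq_sizeP /(_ e (leqnn e)) /eqP; rewrite coefE !mulf_eq0.
rewrite pnatr_eq0 subr_eq0 (negbTE (alphaN _ lt_e _)) //=.
have : lead_coef v != 0 by rewrite lead_coef_eq0 -size_poly_eq0 szvE.
by rewrite /lead_coef szvE => /negbTE ->.
Qed.

End PolynomialSequences.

Section FunctionalCalculus.
Variables (R : realType) (alpha : R) (Q : {poly R}).

(** The operator [Q(J)], for [J] the recurrence operator. *)
Definition qjacobi (f : int -> {poly R}) (n : int) : {poly R} :=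
  \sum_(k < size Q) Q`_k *: iter k (jacobi alpha) f n.

Definition qjacobi_poly (w : {poly R}) : {poly R} :=
  \sum_(k < size Q) Q`_k *: iter k (jacobi_poly alpha) w.

Lemma qjacobi_laguerre n :
  qjacobi (laguerre alpha) n = Q * laguerre alpha n.
Proof.
have iterE k : iter k (jacobi alpha) (laguerre alpha) =
    fun n => 'X^k * laguerre alpha n.
  elim: k => [|k IH]; apply: funext => i; first by rewrite mul1r.
  rewrite iterS IH exprSr -mulrA -jacobi_laguerre /jacobi.
  by rewrite mulrBr mulrDr -!scalerAr.
rewrite -[Q in RHS]coefK poly_def mulr_suml; apply: eq_bigr => k _.
by rewrite iterE scalerAl.
Qed.

Lemma qjacobi_eval w : qjacobi (eval_seq w) = eval_seq (qjacobi_poly w).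
Proof.
have iterE k : iter k (jacobi alpha) (eval_seq w) =
    eval_seq (iter k (jacobi_poly alpha) w).
  by elim: k => [//|k IH]; rewrite !iterS IH jacobi_eval.
apply: funext => n; rewrite /qjacobi /qjacobi_poly /eval_seq horner_sum rmorph_sum.
by apply: eq_bigr => k _; rewrite iterE /eval_seq -mul_polyC -polyCM -hornerZ.
Qed.

End FunctionalCalculus.

(** * Functionals of finitely many consecutive values *)

Section LocalFunctionals.
Variable R : realType.
Implicit Types (F : (int -> {poly R}) -> {poly R}) (hi : int) (N : nat).

(** Indexing the window downwards from its top index [hi] makes the removal of
a leading term, hence Euclidean division, an induction on its length [N].  The
coefficients are scalars while the sequences take polynomial values, so that
one functional can be applied both to the Laguerre polynomials and to scalar
sequences. *)
Definition local hi N F : Prop :=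
  exists a : nat -> R, forall f, F f = \sum_(j < N) a j *: f (hi - j%:Z).

Lemma local_ext hi N F F' : (forall f, F f = F' f) -> local hi N F -> local hi N F'.
Proof. by move=> eqF [a Fa]; exists a => f; rewrite -eqF. Qed.

Lemma local_split hi N F : local hi N.+1 F ->
  exists (c : R) F', local (hi - 1) N F' /\ forall f, F f = c *: f hi + F' f.
Proof.
move=> [a Fa]; exists (a 0%N), (fun f => \sum_(j < N) a j.+1 *: f (hi - 1 - j%:Z)).
split; first by exists (fun j => a j.+1).
move=> f; rewrite Fa big_ord_recl subr0; congr (_ + _).
apply: eq_bigr => j _; rewrite lift0; congr (_ *: f _); lia.
Qed.

Lemma local_cons hi N F c :
  local (hi - 1) N F -> local hi N.+1 (fun f => c *: f hi + F f).
Proof.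
move=> [a Fa]; exists (fun j => if j is i.+1 then a i else c) => f.
rewrite Fa big_ord_recl subr0; congr (_ + _).
apply: eq_bigr => j _; rewrite lift0; congr (_ *: f _); lia.
Qed.

Lemma local_comb hi N F F' c :
  local hi N F -> local hi N F' -> local hi N (fun f => c *: F f + F' f).
Proof.
move=> [a Fa] [b Fb]; exists (fun j => c * a j + b j) => f.
rewrite Fa Fb scaler_sumr -big_split /=.
by apply: eq_bigr => j _; rewrite scalerDl scalerA.
Qed.

Lemma local0 hi N : local hi N (fun=> 0).
Proof. by exists (fun=> 0) => f; rewrite big1 // => j _; rewrite scale0r. Qed.

Lemma local_sum hi N n (c : nat -> R) (F : nat -> (int -> {poly R}) -> {poly R}) :
  (forall i, (i < n)%N -> local hi N (F i)) ->
  local hi N (fun f => \sum_(i < n) c i *: F i f).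
Proof.
elim: n => [|n IH] locF.
  by apply: local_ext (local0 hi N) => f; rewrite big_ord0.
have locFn := IH (fun i lt_in => locF i (ltnW lt_in)).
apply: local_ext (local_comb (c n) (locF n (leqnn _)) locFn) => f.
by rewrite big_ord_recr addrC.
Qed.

Lemma local_widen hi N F hi' N' :
  local hi N F -> hi <= hi' -> hi' - N'%:Z <= hi - N%:Z -> local hi' N' F.
Proof.
have widen_top t : local hi N F -> local (hi + t%:Z) (N + t) F.
  elim: t => [|t IH] locF; first by rewrite addr0 addn0.
  rewrite addnS; have locF' : local (hi + t.+1%:Z - 1) (N + t) F.
    by rewrite (_ : _ - 1 = hi + t%:Z); [exact: IH | lia].
  by apply: local_ext (local_cons 0 locF') => f; rewrite scale0r add0r.
have widen_bot h n u : local h n F -> local h (n + u) F.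
  move=> [a Fa]; exists (fun j => if (j < n)%N then a j else 0) => f.
  rewrite Fa big_split_ord /= [X in _ = _ + X]big1 ?addr0 => [|j _]; last first.
    by rewrite ltnNge leq_addr scale0r.
  by apply: eq_bigr => j _; rewrite ltn_ord.
move=> locF le_hi le_lo.
have := widen_bot _ _ (N' - (N + `|hi' - hi|))%N (widen_top `|hi' - hi|%N locF).
by congr (local _ _ F); lia.
Qed.

Lemma local_point hi N k : k <= hi -> hi - N%:Z < k -> local hi N (fun f => f k).
Proof.
move=> le_k lt_k; apply: (@local_widen k 1); [|by []|lia].
by exists (fun=> 1) => f; rewrite big_ord1 scale1r subr0.
Qed.

Variable alpha : R.

Lemma local_comp_jacobi hi N F :
  local hi N F -> local (hi + 1) N.+2 (fun f => F (jacobi alpha f)).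
Proof.
move=> [a Fa]; apply: (@local_ext _ _ (fun f =>
    \sum_(j < N) a j *: jacobi alpha f (hi - j%:Z))); first by move=> f.
apply: (@local_sum _ _ _ a (fun j f => jacobi alpha f (hi - j%:Z))) => i lt_iN.
set n := hi - i%:Z.
apply: (@local_ext _ _ (fun f => - (n%:~R + alpha) *: f (n - 1)
    + (- (n%:~R + 1) *: f (n + 1)
    + ((2 * n%:~R + alpha + 1) *: f n + 0)))).
  by move=> f; rewrite addr0 addrC /jacobi -[- (_ *: _)]scaleNr.
do 3!(apply: local_comb; first by apply: local_point; rewrite /n; lia).
exact: local0.
Qed.

Lemma local_iter_jacobi n k :
  local (n + k%:Z) k.*2.+1 (fun f => iter k (jacobi alpha) f n).
Proof.
elim: k => [|k IH]; first by apply: local_point; lia.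
rewrite (_ : n + k.+1%:Z = n + k%:Z + 1); last by lia.
by apply: local_ext (local_comp_jacobi IH) => f; rewrite -iterSr.
Qed.

Lemma local_qjacobi (Q : {poly R}) n d : (size Q <= d.+1)%N ->
  local (n + d%:Z) d.*2.+1 (fun f => qjacobi alpha Q f n).
Proof.
move=> le_d; apply: (@local_sum _ _ _ (fun i => Q`_i)
  (fun i f => iter i (jacobi alpha) f n)) => i lt_i.
by apply: local_widen (local_iter_jacobi n i) _ _; lia.
Qed.

End LocalFunctionals.

(** * The Casorati operator *)

Section Casorati.
Variables (R : realType) (G : seq nat) (P : nat -> {poly R}).
Local Notation m := (size G).

(** The zero first row holds the place of a sequence with polynomial values; the
cofactors along it are scalars. *)
Definition casorati_mx (n : int) : 'M[R]_m.+1 :=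
  \matrix_(i, j) if (i : nat) is l.+1 then (P (nth 0%N G l)).[(n - j%:Z)%:~R]
                 else 0.

Definition casorati_coef (n : int) (j : nat) : R :=
  cofactor (casorati_mx n) 0 (inord j).

(** Expansion of the Casorati determinant along its first row: an operator of
order [m] acting on arbitrary sequences. *)
Definition casorati (f : int -> {poly R}) (n : int) : {poly R} :=
  \sum_(j < m.+1) casorati_coef n j *: f (n - j%:Z).

Lemma local_casorati n : local n m.+1 (fun f => casorati f n).
Proof. by exists (casorati_coef n). Qed.

Lemma q_casoratiE alpha n :
  q_casorati alpha G P n = casorati (laguerre alpha) n.
Proof.
case: n => [n|n] /=; last first.
  rewrite /casorati big1 // => j _.
  by rewrite (_ : Negz n - j%:Z = Negz (n + j)) ?scaler0 //; lia.
rewrite (expand_det_row _ 0); apply: eq_bigr => j _.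
rewrite mxE mulrC -mul_polyC; congr (_ * _).
rewrite /casorati_coef inord_val /cofactor rmorphM rmorph_sign -det_map_mx.
by congr (_ * \det _); apply/matrixP => i k; rewrite !mxE.
Qed.

(** The expansion with a row of the family in place of the first row is an
off-diagonal entry of the product of the matrix with its adjugate. *)
Lemma casorati_kernel l n : (l < m)%N ->
  casorati (eval_seq (P (nth 0%N G l))) n = 0.
Proof.
move=> lt_lm; rewrite /casorati /eval_seq.
under eq_bigr => j _ do rewrite -mul_polyC -polyCM mulrC.
rewrite -rmorph_sum -[RHS]polyC0 /=; congr polyC.
pose i : 'I_m.+1 := @Ordinal m.+1 l.+1 lt_lm.
have := congr1 (fun M : 'M_m.+1 => M i 0) (mul_mx_adj (casorati_mx n)).
rewrite !mxE /= mulr0n => adjE; rewrite -[RHS]adjE. apply: eq_bigr => j _.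
by rewrite !mxE /casorati_coef inord_val.
Qed.

(** Both extreme cofactors are determinants of this kind, at [n] and [n + 1]. *)
Definition sample_mx (n : int) : 'M[R]_m :=
  \matrix_(l, j) (P (nth 0%N G l)).[(n - j%:Z - 1)%:~R].

Lemma det_sample_mx n : \det (sample_mx n) = Omega G P n%:~R.
Proof.
rewrite /Omega; congr (\det _); apply/matrixP => l j; rewrite !mxE.
by rewrite (_ : n - j%:Z - 1 = n - j.+1%:Z) ?intrB -?pmulrn //; lia.
Qed.

Lemma casorati_coef_first n : casorati_coef n 0 = Omega G P n%:~R.
Proof.
rewrite -det_sample_mx /casorati_coef /cofactor (_ : inord 0 = 0); last first.
  by apply: val_inj; rewrite /= inordK.
rewrite expr0 mul1r; congr (\det _); apply/matrixP => l j; rewrite !mxE /=.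
by congr (_.[_%:~R]); rewrite /bump /=; lia.
Qed.

Lemma casorati_coef_last n :
  casorati_coef n m = (-1) ^+ m * Omega G P (n + 1)%:~R.
Proof.
rewrite -det_sample_mx /casorati_coef /cofactor inordK // add0n.
congr (_ * \det _); apply/matrixP => l j; rewrite !mxE /= inordK //.
by congr (_.[_%:~R]); rewrite /bump leqNgt ltn_ord add0n; lia.
Qed.

(** The coefficients of the functional solve a homogeneous square linear system
whose matrix, the sampling matrix, is invertible. *)
Lemma local_eq0 n F : Omega G P n%:~R != 0 -> local (n - 1) m F ->
  (forall l, (l < m)%N -> F (eval_seq (P (nth 0%N G l))) = 0) ->
  forall f, F f = 0.
Proof.
rewrite -det_sample_mx -unitfE -unitmxE => unitS [a Fa] FP f.
suff a0 : \col_(j < m) a j = 0.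
  rewrite Fa big1 // => j _.
  by have := congr1 (fun v : 'cV_m => v j 0) a0; rewrite !mxE => ->; rewrite scale0r.
apply: (can_inj (mulKmx unitS)); rewrite mulmx0; apply/colP => l; rewrite !mxE.
apply: (@polyC_inj R); rewrite polyC0 -(FP l (ltn_ord l)) Fa rmorph_sum.
apply: eq_bigr => j _; rewrite !mxE /eval_seq -mul_polyC -polyCM mulrC.
by congr ((_ * _.[_%:~R])%:P); lia.
Qed.

(** The transposed system: its right-hand side lists the values of [w]. *)
Lemma interpolation n (w : {poly R}) : Omega G P n%:~R != 0 ->
  exists a : 'I_m -> R, forall j : nat, (j < m)%N ->
    (w - \sum_l a l *: P (nth 0%N G l)).[(n - j%:Z - 1)%:~R] = 0.
Proof.
rewrite -det_sample_mx -unitfE -unitmxE => unitS.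
pose v : 'rV_m := \row_j w.[(n - j%:Z - 1)%:~R].
exists (fun l => (v *m invmx (sample_mx n)) 0 l) => j lt_jm.
have := congr1 (fun u : 'rV_m => u 0 (Ordinal lt_jm)) (mulmxKV unitS v).
rewrite !mxE /= hornerD hornerN horner_sum => <-.
by apply/eqP; rewrite subr_eq0; apply/eqP/eq_bigr => l _; rewrite hornerZ !mxE.
Qed.

End Casorati.

(** * Extreme coefficients and independence *)

Section Support.
Variables (R : realType) (alpha : R).
Implicit Types (F : (int -> {poly R}) -> {poly R}) (hi : int) (N : nat).

Lemma local_vanish hi N F f : local hi N F ->
  (forall k : int, hi - N%:Z < k <= hi -> f k = 0) -> F f = 0.
Proof.
move=> [a Fa] f0; rewrite Fa big1 // => j _; rewrite f0 ?scaler0 //.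
by have := ltn_ord j; lia.
Qed.

(** Only the path of [k] upward steps reaches the top point; its weight is the
product of the coefficients [-(n + i + 1)], nonzero since [n >= 0]. *)
Lemma iter_jacobi_top (n k : nat) : exists2 c : R, c != 0 &
  forall f : int -> {poly R}, (forall i : int, i < n%:Z + k%:Z -> f i = 0) ->
  iter k (jacobi alpha) f n = c *: f (n%:Z + k%:Z).
Proof.
elim: k => [|k [c c_neq0 IH]].
  by exists 1 => [|f _]; rewrite ?oner_neq0 // addr0 scale1r.
exists (c * - (n + k).+1%:R).
  by rewrite mulf_neq0 // oppr_eq0 pnatr_eq0.
move=> f f0; rewrite iterSr IH => [|i lt_i]; last first.
  by rewrite /jacobi !f0 ?scaler0 ?subr0 ?addr0 //; lia.
rewrite /jacobi [f (_ - 1)]f0 ?[f (n%:Z + k%:Z)]f0; try lia.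
rewrite !scaler0 subr0 addr0 scalerA -PoszD -pmulrn natr1; congr (_ *: f _); lia.
Qed.

(** Likewise for the path of downward steps, whose weight is the product of
the coefficients [-(n - i + alpha)]. *)
Lemma iter_jacobi_bottom (n : int) (k : nat) :
  (forall i : nat, (i < k)%N -> (n - i%:Z)%:~R + alpha != 0) ->
  exists2 c : R, c != 0 &
  forall f : int -> {poly R}, (forall i : int, n - k%:Z < i -> f i = 0) ->
  iter k (jacobi alpha) f n = c *: f (n - k%:Z).
Proof.
elim: k => [|k IH] nz.
  by exists 1 => [|f _]; rewrite ?oner_neq0 // subr0 scale1r.
have [c c_neq0 {}IH] := IH (fun i lt_i => nz i (ltnW lt_i)).
exists (c * - ((n - k%:Z)%:~R + alpha)).
  by rewrite mulf_neq0 // oppr_eq0 nz.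
move=> f f0; rewrite iterSr IH => [|i lt_i]; last first.
  by rewrite /jacobi !f0 ?scaler0 ?subr0 ?addr0 //; lia.
rewrite /jacobi [f (_ + 1)]f0 ?[f (n - k%:Z)]f0; try lia.
rewrite !scaler0 !add0r -scaleNr scalerA; congr (_ *: f _); lia.
Qed.

(** The Laguerre polynomials of nonnegative index have distinct degrees: the
term of highest index cannot be cancelled by the others. *)
Lemma local_laguerre_eq0 hi N F : N%:Z <= hi + 1 -> local hi N F ->
  F (laguerre alpha) = 0 -> forall f, F f = 0.
Proof.
elim: N hi F => [|N IH] hi F le_N locF FL f.
  by case: locF => a ->; rewrite big_ord0.
have [c [F' [locF' FE]]] := local_split locF.
have [h hiE] : exists h : nat, hi = h%:Z by exists `|hi|%N; lia.
have c0 : c = 0.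
  apply/eqP; apply: contraPT FL => c_neq0; rewrite FE.
  have szF' : (size (F' (laguerre alpha)) <= h)%N.
    case: locF' => a ->; apply: (leq_trans (size_sum _ _ _)).
    apply/bigmax_leqP => j _; apply: (leq_trans (size_scale_leq _ _)).
    have -> : hi - 1 - j%:Z = (h - 1 - j)%N by have := ltn_ord j; lia.
    by rewrite size_laguerre; have := ltn_ord j; lia.
  apply/eqP; rewrite -size_poly_eq0 size_polyDl size_scale // hiE size_laguerre //.
have FE' g : F g = F' g by rewrite FE c0 scale0r add0r.
rewrite FE'; apply: (IH (hi - 1)) => //; first by lia.
by rewrite -FE'.
Qed.

End Support.

(** * Difference equations and invariance of the kernel *)

Section Darboux.
Variables (R : realType) (alpha : R) (G : seq nat) (P : nat -> {poly R}).
Hypothesis Omega_neq0 : forall n : nat, Omega G P n%:R != 0.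
Local Notation m := (size G).
Local Notation B := (casorati G P).
Local Notation BQ Q n := (fun f => B (qjacobi alpha Q f) n).

Lemma local_casorati_qjacobi (Q : {poly R}) d n : (size Q <= d.+1)%N ->
  local (n + d%:Z) (d.*2.+1 + m) (BQ Q n).
Proof.
move=> le_d; apply: (@local_sum _ _ _ _ (casorati_coef G P n)
  (fun j f => qjacobi alpha Q f (n - j%:Z))) => j lt_j.
by apply: local_widen (local_qjacobi _ (n - j%:Z) le_d) _ _; lia.
Qed.

Lemma casorati_qjacobi_top (Q : {poly R}) d (n : nat) : size Q = d.+1 ->
  exists2 c : R, c != 0 &
  forall f : int -> {poly R}, (forall i : int, i < n%:Z + d%:Z -> f i = 0) ->
  B (qjacobi alpha Q f) n = c *: f (n%:Z + d%:Z).
Proof.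
move=> szQ; have [c c_neq0 cE] := iter_jacobi_top alpha n d.
exists (casorati_coef G P n 0 * (Q`_d * c)).
  rewrite casorati_coef_first -pmulrn !mulf_neq0 //.
  by rewrite -[d]/(d.+1.-1) -szQ lead_coef_eq0 -size_poly_eq0 szQ.
move=> f f0; rewrite /casorati big_ord_recl subr0 big1 ?addr0 => [|j _]; last first.
  rewrite (@local_vanish _ _ _ (fun f => qjacobi alpha Q f _) f
    (local_qjacobi _ (n%:Z - (lift ord0 j)%:Z) (eq_leq szQ))) ?scaler0 //.
  by move=> i; rewrite lift0 => lt_i; apply: f0; lia.
rewrite -[RHS]scalerA; congr (_ *: _).
rewrite /qjacobi szQ big_ord_recr /= big1 ?add0r ?cE ?scalerA // => k _.
rewrite (@local_vanish _ _ _ (fun f => iter k _ f n) f (local_iter_jacobi alpha n k)) ?scaler0 //.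
by move=> i lt_i; apply: f0; have := ltn_ord k; lia.
Qed.

Lemma casorati_qjacobi_bottom (Q : {poly R}) d (n : nat) : size Q = d.+1 ->
  (forall k : nat, alpha - m%:R + k.+1%:R != 0) -> (d <= n)%N ->
  exists2 c : R, c != 0 &
  forall f : int -> {poly R}, (forall i : int, n%:Z - m%:Z - d%:Z < i -> f i = 0) ->
  B (qjacobi alpha Q f) n = c *: f (n%:Z - m%:Z - d%:Z).
Proof.
move=> szQ alphaN le_dn.
have [|c c_neq0 cE] := @iter_jacobi_bottom _ alpha (n%:Z - m%:Z) d.
  move=> i lt_i; have [k nE] : exists k, n = (i + k.+1)%N.
    by exists (n - i).-1; lia.
  apply: contraNneq (alphaN k) => <-; rewrite nE.
  rewrite (_ : (i + k.+1)%:Z - m%:Z - i%:Z = k.+1%:Z - m%:Z); last by lia.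
  by apply/eqP; rewrite intrB -!pmulrn; ring.
exists (casorati_coef G P n m * (Q`_d * c)).
  rewrite casorati_coef_last -PoszD -pmulrn !mulf_neq0 ?signr_eq0 //.
  by rewrite -[d]/(d.+1.-1) -szQ lead_coef_eq0 -size_poly_eq0 szQ.
move=> f f0; rewrite /casorati big_ord_recr /= big1 ?add0r => [|j _]; last first.
  rewrite (@local_vanish _ _ _ (fun f => qjacobi alpha Q f _) f
    (local_qjacobi _ (n%:Z - (widen_ord _ j)%:Z) (eq_leq szQ))) ?scaler0 //.
  by move=> i /= lt_i; apply: f0; have := ltn_ord j; lia.
rewrite -[RHS]scalerA; congr (_ *: _).
rewrite /qjacobi szQ big_ord_recr /= big1 ?add0r ?cE ?scalerA // => k _.
rewrite (@local_vanish _ _ _ (fun f => iter k _ f _) f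
  (local_iter_jacobi alpha (n%:Z - m%:Z) k)) ?scaler0 //.
by move=> i lt_i; apply: f0; have := ltn_ord k; lia.
Qed.

(** Each step divides by the leading coefficient [Omega (hi - i)], which is why
the quotient must stop at the index [0]. *)
Lemma casorati_division (t K : nat) hi F : (m <= K)%N -> local hi (t + K) F ->
  t%:Z <= hi + 1 ->
  exists g : nat -> R, local (hi - t%:Z) K
    (fun f => F f - \sum_(i < t) g i *: B f (hi - i%:Z)).
Proof.
move=> le_mK; elim: t hi F => [|t IH] hi F locF le_t.
  exists (fun=> 0); rewrite subr0; apply: local_ext locF => f.
  by rewrite big_ord0 subr0.
have [c [F' [locF' FE]]] := local_split locF.
have [b [B' [locB' BE]]] := local_split (local_casorati G P hi).
have b_neq0 : b != 0.
  have [h hiE] : exists h : nat, hi = h%:Z by exists `|hi|%N; lia.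
  pose delta i : {poly R} := (i == hi)%:R.
  have : B delta hi = (casorati_coef G P hi 0)%:P.
    rewrite /casorati big_ord_recl subr0 big1 => [|j _]; last first.
      by rewrite /delta lift0 (_ : _ == _ = false) ?scaler0 //; lia.
    by rewrite /delta eqxx addr0 alg_polyC.
  rewrite BE (local_vanish locB') => [|k le_k]; last first.
    by rewrite /delta (_ : _ == _ = false) //; lia.
  rewrite /delta eqxx addr0 alg_polyC => /polyC_inj ->.
  by rewrite casorati_coef_first hiE -pmulrn.
have locF1 : local (hi - 1) (t + K) (fun f => F f - c / b *: B f hi).
  have locB'' : local (hi - 1) (t + K) B' by apply: local_widen locB' _ _; lia.
  apply: local_ext (local_comb (- (c / b)) locB'' locF') => f.
  rewrite FE BE scalerDr scalerA divfK // scaleNr opprD addrACA subrr add0r.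
  by rewrite addrC.
have [|g locg] := IH _ _ locF1; first by lia.
exists (fun i => if i is j.+1 then g j else c / b).
rewrite (_ : hi - t.+1%:Z = hi - 1 - t%:Z); last by lia.
apply: local_ext locg => f.
rewrite big_ord_recl subr0 opprD addrA; congr (_ - _).
by apply: eq_bigr => i _; rewrite lift0; congr (_ *: B f _); lia.
Qed.

Lemma diff_op_sym (gamma : nat -> int -> R) d f n :
  diff_op (- d%:Z) d gamma f n =
  \sum_(i < d.*2.+1) gamma n (d%:Z - i%:Z) *: f (n%:Z + d%:Z - i%:Z).
Proof.
rewrite /diff_op (_ : `|d%:Z - - d%:Z|%N = d.*2); last by lia.
rewrite (reindex_inj rev_ord_inj); apply: eq_bigr => i _ /=.
by have lt_i := ltn_ord i; congr (gamma n _ *: f _); lia.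
Qed.

Section Quotient.
Variable Q : {poly R}.
Hypothesis Q_neq0 : Q != 0.
Hypothesis alphaN : forall k : nat, alpha - m%:R + k.+1%:R != 0.
Hypothesis kerQ : forall l n, (l < m)%N ->
  BQ Q n (eval_seq (P (nth 0%N G l))) = 0.

(** If [Q(J)] sends the family into the kernel of the Casorati operator [B],
then the remainder of the division of [B Q(J)] by [B] vanishes on the Laguerre
polynomials, and for [n >= d] on all sequences.  The quotient inherits nonzero
extreme coefficients from [B] and [Q(J)]. *)
Lemma quotient_row d (n : nat) : size Q = d.+1 ->
  exists gam : int -> R, [/\ gam (- d%:Z) != 0, gam d%:Z != 0 &
    \sum_(i < d.*2.+1) gam (d%:Z - i%:Z) *:
       q_casorati alpha G P (n%:Z + d%:Z - i%:Z) =
    Q * q_casorati alpha G P n%:Z].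
Proof.
move=> szQ.
(* The quotient has [t] terms: one for each shift from [d] down to [-d], except
   that it stops at the index [0], below which [q] vanishes. *)
pose t := (d + minn n d).+1; pose K := (d + m - minn n d)%N.
have locF : local (n%:Z + d%:Z) (t + K) (BQ Q n).
  by apply: local_widen (local_casorati_qjacobi n (eq_leq szQ)) _ _; rewrite /t /K; lia.
have [||g locg] := casorati_division _ locF; try (rewrite /t /K; lia).
pose rest f := BQ Q n f - \sum_(i < t) g i *: B f (n%:Z + d%:Z - i%:Z).
have rest0 : (d <= n)%N -> forall f, rest f = 0.
  move=> le_dn; apply: (@local_eq0 _ G P (n - d)%N); first by rewrite -pmulrn.
    by apply: local_widen locg _ _; rewrite /t /K; lia.
  move=> l lt_l; rewrite /rest kerQ // big1 ?subrr // => i _.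
  by rewrite casorati_kernel ?scaler0.
have restL : rest (laguerre alpha) = 0.
  have [lt_nd|le_dn] := ltnP n d.
    apply: (local_vanish locg) => k le_k.
    have [j ->] : exists j, k = Negz j by exists `|(k + 1)%R|%N; rewrite /t in le_k; lia.
    by [].
  exact: rest0.
have FE f : BQ Q n f = rest f + \sum_(i < t) g i *: B f (n%:Z + d%:Z - i%:Z).
  by rewrite /rest subrK.
pose delta (k i : int) : {poly R} := (i == k)%:R.
have delta1 k : delta k k = 1 by rewrite /delta eqxx.
have delta0 k i : i <> k -> delta k i = 0 by rewrite /delta => /eqP/negbTE ->.
(* Shifts below the quotient only meet [q] at negative indices, so any nonzero
   coefficient will do there. *)
exists (fun i => if (`|d%:Z - i| < t)%N then g `|d%:Z - i|%N else 1); split.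
- rewrite (_ : `|d%:Z - - d%:Z|%N = d.*2); last by lia.
  case: ifP => [lt_t|_]; last exact: oner_neq0.
  have le_dn : (d <= n)%N by rewrite /t in lt_t; lia.
  have [c c_neq0 cE] := casorati_qjacobi_bottom szQ alphaN le_dn.
  (* Both sides are evaluated on the unit sequence at the lowest point, which
     only the last term of the quotient reaches. *)
  pose k : int := n%:Z - m%:Z - d%:Z.
  apply: contraNneq c_neq0 => g0; apply/eqP/(@polyC_inj R).
  have := cE (delta k); rewrite FE rest0 // add0r -/k delta1 alg_polyC polyC0 => <-.
    rewrite big1 // => i _.
    have [->|ne_i] := eqVneq (i : nat) d.*2; first by rewrite g0 scale0r.
    rewrite (local_vanish (local_casorati G P _)) ?scaler0 // => j.
    have lt_i : (i < d.*2.+1)%N.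
      by rewrite (leq_trans (ltn_ord i)) // /t; lia.
    move=> lt_j.
    by apply: delta0; rewrite /k; lia.
  by move=> i lt_i; apply: delta0; rewrite /k; lia.
- rewrite subrr /=.
  have [c c_neq0 cE] := casorati_qjacobi_top n szQ.
  (* Now the unit sequence at the highest point, reached by the first term
     only. *)
  pose k : int := n%:Z + d%:Z.
  apply: contraNneq c_neq0 => g0; apply/eqP/(@polyC_inj R).
  have := cE (delta k); rewrite FE -/k delta1 alg_polyC polyC0 => <-.
    have -> : rest (delta k) = 0.
      apply: (local_vanish locg) => j lt_j.
      by apply: delta0; rewrite /k; rewrite /t in lt_j; lia.
    rewrite add0r big1 // => i _.
    have [->|ne_i] := eqVneq (i : nat) 0%N; first by rewrite g0 scale0r.
    rewrite (local_vanish (local_casorati G P _)) ?scaler0 // => j lt_j.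
    by apply: delta0; rewrite /k; lia.
  by move=> i lt_i; apply: delta0; rewrite /k; lia.
have -> : Q * q_casorati alpha G P n = BQ Q n (laguerre alpha).
  rewrite q_casoratiE /casorati mulr_sumr; apply: eq_bigr => j _.
  by rewrite qjacobi_laguerre scalerAr.
rewrite FE restL add0r.
have le_t : (t <= d.*2.+1)%N by rewrite /t; lia.
rewrite -(subnKC le_t) big_split_ord /= [X in _ + X]big1 ?addr0 => [|i _].
  apply: eq_bigr => i _; rewrite q_casoratiE.
  have -> : `|(d%:Z - (d%:Z - i%:Z))%R|%N = i by lia.
  by rewrite ltn_ord.
have [j ->] : exists j, n%:Z + d%:Z - (t + i)%:Z = Negz j.
  by exists (t + i - n - d).-1; have := ltn_ord i; rewrite /t; lia.
by rewrite scaler0.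
Qed.

Lemma Dtilde_of_kernel : Dtilde (q_casorati alpha G P) Q.
Proof.
have [d szQ] : exists d, size Q = d.+1.
  by exists (size Q).-1; rewrite prednK // lt0n size_poly_eq0.
have [gamma gammaP] := choice (fun n => quotient_row n szQ).
exists (- d%:Z), d%:Z, gamma; split; first by lia.
  by left=> n; have [] := gammaP n.
by move=> n; rewrite diff_op_sym; have [_ _] := gammaP n.
Qed.

End Quotient.

Lemma poly_eq0_of_large_zeros (u : {poly R}) (N : int) :
  (forall n : int, N <= n -> u.[n%:~R] = 0) -> u = 0.
Proof.
move=> u0; apply/eqP; apply: contraT => u_neq0.
pose s := [seq (N + i%:Z)%:~R : R | i <- iota 0 (size u)].
have /(max_poly_roots u_neq0) : all (root u) s.
  by apply/allP => x /mapP[i _ ->]; apply/rootP/u0; lia.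
rewrite size_map size_iota ltnn; apply.
rewrite map_inj_uniq ?iota_uniq // => i j /intr_inj; lia.
Qed.

Lemma casorati_eval_sub_sum (v : {poly R}) k (a : 'I_k -> R)
    (p : 'I_k -> {poly R}) n :
  B (eval_seq (v - \sum_i a i *: p i)) n =
  B (eval_seq v) n - \sum_i a i *: B (eval_seq (p i)) n.
Proof.
have -> : \sum_i a i *: B (eval_seq (p i)) n = \sum_(j < m.+1) \sum_i
    a i *: (casorati_coef G P n j *: eval_seq (p i) (n - j%:Z)).
  by rewrite exchange_big; apply: eq_bigr => i _; rewrite scaler_sumr.
rewrite /casorati -sumrB; apply: eq_bigr => j _ /=.
rewrite /eval_seq hornerD hornerN horner_sum polyCB rmorph_sum scalerBr.
congr (_ - _); rewrite scaler_sumr; apply: eq_bigr => i _.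
by rewrite hornerZ /= polyCM mul_polyC !scalerA mulrC.
Qed.

(** For [n] large, [D B] and [B Q(J)] only involve nonnegative indices and agree
on the Laguerre polynomials, hence on all sequences.  So [Q(J) w] is a solution
of the recurrence defined by [B], and such a solution is determined by [m]
consecutive values, which the family can interpolate. *)
Lemma span_of_Dtilde (Q : {poly R}) l : (l < m)%N ->
  Dtilde (q_casorati alpha G P) Q ->
  exists a : 'I_m -> R,
    qjacobi_poly alpha Q (P (nth 0%N G l)) = \sum_k a k *: P (nth 0%N G k).
Proof.
move=> lt_l [s [r [gamma [le_sr _ eqQ]]]].
(* Beyond [N0] neither operator reaches below the index [0]. *)
pose d := size Q; pose N0 := (m + d + `|s|)%N.
set v := qjacobi_poly _ _ _.
have Bv (n : nat) : (N0 <= n)%N -> B (eval_seq v) n = 0.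
  move=> le_n.
  pose D f := BQ Q n f - diff_op s r gamma (B f) n.
  pose hi := (n + d + `|s| + `|r - s|)%N.
  have locD : local hi hi.+1 D.
    have locS : local hi hi.+1 (fun f => diff_op s r gamma (B f) n).
      apply: (@local_sum _ _ _ _ (fun k => gamma n (s + k%:Z))
        (fun k f => B f (n%:Z + (s + k%:Z)))) => k lt_k.
      by apply: local_widen (local_casorati G P _) _ _; rewrite /hi; lia.
    have locQ : local hi hi.+1 (BQ Q n).
      apply: local_widen (local_casorati_qjacobi n (leqnSn d)) _ _; rewrite /hi /N0 in le_n *; lia.
    by apply: local_ext (local_comb (-1) locS locQ) => f; rewrite scaleN1r addrC.
  have D0 : forall f, D f = 0.
    apply: (@local_laguerre_eq0 _ alpha _ _ _ _ locD); first by lia.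
    have qE : q_casorati alpha G P = B (laguerre alpha).
      by apply: funext => i; rewrite q_casoratiE.
    have -> : D (laguerre alpha) = B (qjacobi alpha Q (laguerre alpha)) n -
        diff_op s r gamma (B (laguerre alpha)) n by [].
    rewrite -qE eqQ qE mulr_sumr; apply/eqP; rewrite subr_eq0; apply/eqP.
    by apply: eq_bigr => j _; rewrite qjacobi_laguerre scalerAr.
  rewrite /v -qjacobi_eval; move/eqP: (D0 (eval_seq (P (nth 0%N G l)))).
  rewrite subr_eq0 => /eqP ->; rewrite /diff_op big1 // => k _.
  by rewrite casorati_kernel ?scaler0.
have [a aP] := @interpolation _ G P N0%:Z v (Omega_neq0 N0).
exists a; apply/eqP; rewrite -subr_eq0; apply/eqP; set u := v - _ in aP *.
have Bu (n : nat) : (N0 <= n)%N -> B (eval_seq u) n = 0.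
  move=> le_n.
  transitivity (B (eval_seq v) n -
      \sum_k a k *: B (eval_seq (P (nth 0%N G k))) n).
    exact: casorati_eval_sub_sum.
  rewrite Bv // big1 ?subr0 // => k _.
  by rewrite casorati_kernel ?scaler0.
apply: (@poly_eq0_of_large_zeros _ (N0%:Z - m%:Z)) => n le_n.
have [k -> {n le_n}] : exists k : nat, n = N0%:Z - m%:Z + k%:Z.
  by exists `|(n - (N0%:Z - m%:Z))%R|%N; lia.
elim/ltn_ind: k => k IH.
have [lt_km|le_mk] := ltnP k m.
  have := aP (m - k.+1)%N; rewrite (_ : N0%:Z - _ - 1 = N0%:Z - m%:Z + k%:Z); last by lia.
  by apply; lia.
have [n nE] : exists n, (k = n + m)%N by exists (k - m)%N; lia.
have := Bu (N0 + n)%N (leq_addr _ _).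
rewrite /casorati big_ord_recl big1 => [|j _]; last first.
  rewrite lift0 /eval_seq (_ : (N0 + n)%:Z - j.+1%:Z = N0%:Z - m%:Z + (k - j.+1)%:Z).
    by rewrite IH ?polyC0 ?scaler0 //; lia.
  by have := ltn_ord j; lia.
rewrite subr0 addr0 casorati_coef_first /eval_seq => /eqP.
rewrite scaler_eq0 (negbTE (Omega_neq0 _)) polyC_eq0 /= => /eqP un0.
by rewrite -[RHS]un0; congr (u.[_%:~R]); lia.
Qed.

End Darboux.

(** * Degrees *)

Section DegreeArguments.
Variable R : realType.

(** The term of highest degree in a combination of polynomials of distinct
degrees at least [f] cannot be cancelled. *)
Lemma small_comb_eq0 f n (a : 'I_n -> R) (p : nat -> {poly R}) :
  (forall l, (l < n)%N -> size (p l) = (f + l).+1) ->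
  (size (\sum_l a l *: p l)%R <= f)%N -> \sum_l a l *: p l = 0.
Proof.
elim: n a => [|n IH] a szp; first by rewrite big_ord0.
have szlow : (size (\sum_(l < n) a (widen_ord (leqnSn n) l) *: p l)%R <= f + n)%N.
  apply: (leq_trans (size_sum _ _ _)); apply/bigmax_leqP => l _.
  apply: (leq_trans (size_scale_leq _ _)).
  by have lt_ln := ltn_ord l; rewrite szp; lia.
rewrite big_ord_recr /= => le_f.
have an0 : a ord_max = 0.
  have /leq_sizeP /(_ (f + n)%N (leq_addr _ _)) := le_f.
  rewrite coefD coefZ nth_default // add0r => /eqP.
  have : lead_coef (p n) != 0 by rewrite lead_coef_eq0 -size_poly_eq0 szp.
  by rewrite /lead_coef szp // mulf_eq0 => /negbTE -> /=; rewrite orbF => /eqP.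
rewrite an0 scale0r addr0 in le_f *.
by apply: IH => // l lt_ln; apply: szp; lia.
Qed.

Variable alpha : R.

(** The powers of [J] above [N] annihilate the polynomials of degree at most
[N]. *)
Lemma qjacobi_poly_const (Q w : {poly R}) (N : nat) : (size w <= N.+1)%N ->
  (forall k : nat, (0 < k <= N)%N -> Q`_k = 0) ->
  qjacobi_poly alpha Q w = Q`_0 *: w.
Proof.
move=> le_w Q0; rewrite /qjacobi_poly.
case szQ: (size Q) => [|d].
  by rewrite big_ord0 nth_default ?szQ // scale0r.
rewrite big_ord_recl /= big1 ?addr0 // => k _; rewrite /bump /= add1n.
have [le_kN|lt_Nk] := leqP k.+1 N; first by rewrite Q0 ?scale0r.
have := size_iter_jacobi_le alpha k.+1 w.
rewrite (_ : (size w - k.+1)%N = 0%N); last by lia.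
by rewrite leqn0 size_poly_eq0 => /eqP /= ->; rewrite scaler0.
Qed.

(** The lowest surviving power of [J] lowers the degree by exactly its
exponent, and the higher powers lower it more. *)
Lemma size_qjacobi_poly_sub (Q w : {poly R}) k :
  (0 < k < size w)%N -> Q`_k != 0 ->
  (forall i : nat, (0 < i < k)%N -> Q`_i = 0) ->
  (forall i : nat, (i < size w)%N -> (0 < i)%N -> alpha != i%:R) ->
  size (qjacobi_poly alpha Q w - Q`_0 *: w) = (size w - k)%N.
Proof.
move=> /andP[k_gt0 lt_k] Qk_neq0 Qlow alphaN.
have lt_kQ : (k < size Q)%N.
  by rewrite ltnNge; apply: contra Qk_neq0 => le_Qk; rewrite nth_default.
rewrite /qjacobi_poly -(big_mkord xpredT (fun i => Q`_i *: iter i (jacobi_poly alpha) w)).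
rewrite big_ltn ?(leq_trans _ lt_kQ) //= addrAC subrr add0r.
rewrite (big_cat_nat k_gt0 (ltnW lt_kQ)) /= big_nat big1 ?add0r => [|i i_in]; last first.
  by rewrite Qlow ?scale0r.
rewrite big_ltn // size_polyDl size_scale // size_iter_jacobi //.
rewrite big_nat; apply: (@leq_ltn_trans (size w - k.+1)); last by lia.
apply: (big_ind (fun u : {poly R} => size u <= size w - k.+1)%N) => [|u v le_u le_v|i].
- by rewrite size_poly0.
- by rewrite (leq_trans (size_polyD _ _)) // geq_max le_u.
move=> /andP[lt_ki _]; apply: (leq_trans (size_scale_leq _ _)).
by apply: (leq_trans (size_iter_jacobi_le _ _ _)); lia.
Qed.

End DegreeArguments.

Theorem corollary4p4 (R : realType) (alpha : R) (G : seq nat)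
    (P : nat -> {poly R})
    (G_nonempty : (0 < size G)%N)
    (G_increasing : sorted ltn G)
    (G_pos : forall g : nat, g \in G -> (0 < g)%N)
    (P_size : forall g : nat, g \in G -> size (P g) = g.+1)
    (P_lead : forall g : nat, g \in G -> lead_coef (P g) = (g`!)%:R^-1)
    (alphaP : forall k : nat, alpha - (\max_(g <- G) g)%N%:R != - k%:R)
    (Omega_neq0 : forall n : nat, Omega G P n%:R != 0)
    (G_segment : exists f h : nat, (0 < f)%N /\
       forall g : nat, (g \in G) = (f <= g <= f + h)%N) :
  Dtilde (q_casorati alpha G P) =
  [set Q | exists (p : {poly R}) (c : R),
     Q = p * 'X^((\max_(g <- G) g)%N.+1) + c%:P]%classic.
Proof.
have [f [h [f_gt0 memG]]] := G_segment.
have GE : G = iota f h.+1.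
  apply: (irr_sorted_eq ltn_trans ltnn) => //; first exact: iota_ltn_sorted.
  by move=> g; rewrite memG mem_iota addnS ltnS.
have sizeG : size G = h.+1 by rewrite GE size_iota.
have nthG l : (l < size G)%N -> nth 0%N G l = (f + l)%N.
  by rewrite sizeG => lt_l; rewrite GE nth_iota.
have maxG : (\max_(g <- G) g)%N = (f + h)%N.
  apply/eqP; rewrite eqn_leq; apply/andP; split.
    by apply/bigmax_leqP_seq => g; rewrite memG => /andP[].
  by apply: (@leq_bigmax_seq _ _ xpredT id) => //; rewrite memG; lia.
rewrite maxG in alphaP *; set M := (f + h)%N in alphaP *.
have szP l : (l < size G)%N -> size (P (nth 0%N G l)) = (f + l).+1.
  by move=> lt_l; rewrite P_size ?mem_nth // nthG.
have alpha_neq (i : nat) : (i <= M)%N -> alpha != i%:R.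
  move=> le_i; apply: contraNneq (alphaP (M - i)%N) => ->.
  by rewrite natrB // opprB.
apply/seteqP; split => Q /=.
  move=> DQ; exists (drop_poly M.+1 Q), Q`_0.
  suff Qlow k : (0 < k <= M)%N -> Q`_k = 0.
    rewrite -{1}(poly_take_drop M.+1 Q) addrC; congr (_ + _).
    apply/polyP => k; rewrite coef_take_poly coefC ltnS.
    case: k => [//|k] /=; case: ifP => // le_k; exact: Qlow.
  elim/ltn_ind: k => k IH /andP[k_gt0 le_kM].
  apply/eqP; apply: contraT => Qk_neq0.
  (* The least degree in the segment that is at least [k]; lowering it by [k]
     leaves the segment from below, as both [k] and [f] are positive. *)
  pose g := maxn k f; pose l := (g - f)%N.
  have lt_l : (l < size G)%N by rewrite sizeG /l /g /M in le_kM *; lia.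
  set w := P (nth 0%N G l).
  have szw : size w = g.+1 by rewrite /w szP // /l /g; lia.
  have [a aE] := span_of_Dtilde Omega_neq0 lt_l DQ.
  pose a' i := a i - Q`_0 * (i == Ordinal lt_l)%:R.
  have uE : qjacobi_poly alpha Q w - Q`_0 *: w =
      \sum_i a' i *: P (nth 0%N G i).
    under eq_bigr => i _ do rewrite scalerBl -scalerA.
    rewrite sumrB -aE; congr (_ - _); rewrite -scaler_sumr; congr (_ *: _).
    rewrite (bigD1 (Ordinal lt_l)) //= eqxx scale1r big1 ?addr0 // => i /negbTE ->.
    by rewrite scale0r.
  have szu : size (qjacobi_poly alpha Q w - Q`_0 *: w) = (size w - k)%N.
    apply: size_qjacobi_poly_sub => //.
    - by rewrite szw k_gt0 /g ltnS leq_maxl.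
    - by move=> i /andP[i_gt0 lt_ik]; apply: IH => //; rewrite i_gt0 /=; lia.
    - move=> i lt_i _; apply: alpha_neq; rewrite szw in lt_i.
      by rewrite /g /M in lt_i le_kM *; lia.
  have u0 := @small_comb_eq0 _ f _ a' (fun i => P (nth 0%N G i)) szP.
  have := szu; rewrite uE u0 ?size_poly0; last first.
    by rewrite -uE szu szw /g; lia.
  by rewrite szw /g => sz0; exfalso; lia.
case=> p [c QE].
have Qlow k : (0 < k <= M)%N -> Q`_k = 0.
  move=> /andP[k_gt0 le_k]; rewrite QE coefD coefMXn ltnS le_k coefC add0r.
  by case: k k_gt0 {le_k}.
have [->|Q_neq0] := eqVneq Q 0.
  exists 0, 0, (fun _ _ => 0); split=> //; first by right.
  by move=> n; rewrite /diff_op big1 ?mul0r // => k _; rewrite scale0r.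
apply: Dtilde_of_kernel => //.
  move=> k; apply: contraNneq (alphaP (M - h + k)%N) => alphaE.
  rewrite -subr_eq0 opprK -alphaE sizeG natrD natrB ?leq_addl //.
  by rewrite -!natr1; apply/eqP; ring.
move=> l n lt_l; have lt_lh : (l < h.+1)%N by rewrite -sizeG.
have -> : qjacobi alpha Q (eval_seq (P (nth 0%N G l))) =
    eval_seq (Q`_0 *: P (nth 0%N G l)).
  rewrite qjacobi_eval (@qjacobi_poly_const _ _ _ _ M) // szP // /M; lia.
rewrite (_ : casorati _ _ _ _ = Q`_0 *: casorati G P (eval_seq (P (nth 0%N G l))) n).
  by rewrite casorati_kernel ?scaler0.
rewrite /casorati scaler_sumr; apply: eq_bigr => j _.
by rewrite /eval_seq hornerZ polyCM mul_polyC !scalerA mulrC.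
Qed.
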